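(* Let $f$ be a non-zero binary $n$-ic form with integer coefficients. Then: (a) the fractional ideal $I_f$ is invertible if and only if the form $f$ is primitive; (b) the fractional ideal $I_f^\#$ is invertible if and only if the form $f$ is primitive; (c) one always has $I_f^\#=(R_f:I_f)$; (d) in the case that $f$ is primitive, $I_f^{-1}=I_f^\#$.
   Context: A binary $n$-ic form is $f=f_0x^n+f_1x^{n-1}y+\dots+f_ny^n$ with $f_i\in\mathbb{Z}$; it is primitive if its coefficients generate the unit ideal of $\mathbb{Z}$. If $f_0\neq0$, put $Q_f=\mathbb{Q}[\theta]/(f_0\theta^n+f_1\theta^{n-1}+\dots+f_n)$, $\zeta_0=1$, and $\zeta_k=f_0\theta^k+f_1\theta^{k-1}+\dots+f_{k-1}\theta$ for $1\le k\le n-1$. Then $R_f$ is the $\mathbb{Z}$-span of $\zeta_0,\dots,\zeta_{n-1}$, which is a subring of $Q_f$. $I_f=(1,\theta)$ is the $R_f$-submodule of $Q_f$ generated by $1$ and $\theta$. $I_f^\#$ is the $\mathbb{Z}$-span of $f_0,\ f_0\theta+f_1,\ \dots,\ f_0\theta^{n-1}+f_1\theta^{n-2}+\dots+f_{n-1}$, which is an ideal of $R_f$. For $A,B\subset Q_f$, $(A:B)=\{x\in Q_f: xB\subset A\}$. A fractional ideal $J\subset Q_f$ of $R_f$ is invertible if $JJ'=R_f$ for some fractional ideal $J'\subset Q_f$, and then $J^{-1}=J'$. If $f\ne0$ but $f_0=0$, one chooses $\gamma\in GL_2(\mathbb{Z})$ (acting by linear substitution of variables) such that $f'=\gamma f$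 has nonzero $x^n$-coefficient, and $R_f,I_f,I_f^\#$ mean $R_{f'},I_{f'},I_{f'}^\#$; the ring and ideal classes do not depend on the choice up to isomorphism.
   Formalization: The degree n is assumed to be at least 2; for n = 1 the claim fails, e.g. f = 2x has R_f = I_f = Z (invertible although f is not primitive), while I_f^# = 2Z differs from (R_f : I_f) = Z. *)

(* Defs.v *)
From HB Require Import structures.
From mathcomp Require Import all_boot all_order all_algebra.
From mathcomp Require Export mpoly.

Set Implicit Arguments.
Unset Strict Implicit.
Unset Printing Implicit Defensive.

Import GRing.Theory.
Local Open Scope ring_scope.

(* A subset of a commutative ring is a predicate [T -> Prop]. *)
Section Fractional.
Variable T : comNzRingType.
Implicit Types R A B J : T -> Prop.

Definition eq_sub A B := forall x, A x <-> B x.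

(* The submodule over the subring [R] generated by the finite family [s]. *)
Definition Rspan R (s : seq T) (x : T) : Prop :=
  exists c : 'I_(size s) -> T,
    (forall i, R (c i)) /\ x = \sum_(i < size s) c i * s`_i.

(* Finitely generated submodules over the subring [R]. *)
Definition fractional R J := exists s : seq T, eq_sub J (Rspan R s).

Definition prod_sub A B (x : T) : Prop :=
  exists s : seq (T * T),
    (forall p, p \in s -> A p.1 /\ B p.2) /\ x = \sum_(p <- s) p.1 * p.2.

Definition colon A B (x : T) : Prop := forall y, B y -> A (x * y).

(* [J] is an invertible fractional ideal of [R] and [J'] is its inverse. *)
Definition is_inverse R J J' :=
  [/\ fractional R J, fractional R J' & eq_sub (prod_sub J J') R].

Definition invertible R J := exists J', is_inverse R J J'.

End Fractional.

Section Form.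
Variables (n : nat) (f : {mpoly int[2]}).

(* With x = 'X_0 and y = 'X_1, the coefficient of x^(n - k) y^k. *)
Definition fcoef (k : nat) : int :=
  f@_[multinom [tuple (n - k)%N; k]].

Definition primitive_form : Prop :=
  exists c : 'I_n.+1 -> int, \sum_(i < n.+1) c i * fcoef i = 1.

(* f(X, 1) *)
Definition dehomog : {poly rat} :=
  \sum_(k < n.+1) (fcoef k)%:~R *: 'X^(n - k).

(* [{poly %/ p}] is the quotient by p only for p monic of positive degree;
   hence the division by the leading coefficient.  The value is meaningful for
   [fcoef 0 != 0] and [0 < n]. *)
Definition Qf := {poly %/ ((fcoef 0)%:~R^-1 *: dehomog)}.
HB.instance Definition _ := GRing.ComUnitAlgebra.on Qf.

Definition theta : Qf := 'qX.

Definition zeta (k : nat) : Qf :=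
  if k == 0%N then 1 else \sum_(i < k) (fcoef i)%:~R * theta ^+ (k - i).

Definition eta (k : nat) : Qf :=
  \sum_(i < k.+1) (fcoef i)%:~R * theta ^+ (k - i).

Definition Rf (x : Qf) : Prop := inIntSpan [tuple zeta k | k < n] x.

Definition If : Qf -> Prop := Rspan Rf [:: 1; theta].

Definition Ifsharp (x : Qf) : Prop := inIntSpan [tuple eta k | k < n] x.

End Form.

Arguments Rf n f x : clear implicits.
Arguments If n f _ : clear implicits.
Arguments Ifsharp n f x : clear implicits.

(* f(a x + b y, c x + d y) for g = ((a, b), (c, d)) *)
Definition subst_form (g : 'M[int]_2) (f : {mpoly int[2]}) : {mpoly int[2]} :=
  f \mPo [tuple \sum_(j < 2) g i j *: 'X_j | i < 2].

(* [f'] may be used to define R_f, I_f and I_f^#: it is f itself if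
   f_0 <> 0, and otherwise any GL_2(Z)-translate of f with f'_0 <> 0. *)
Definition admissible n (f f' : {mpoly int[2]}) : Prop :=
  if fcoef n f 0 != 0 then f' = f
  else exists2 g : 'M[int]_2,
         g \in unitmx & f' = subst_form g f /\ fcoef n f' 0 != 0.

Lemma admissible_exists n (f : {mpoly int[2]}) :
  f \is n.-homog -> f != 0 -> exists f', admissible n f f'.
Proof.
move=> fh f0; rewrite /admissible.
case: (fcoef n f 0 != 0); first by exists f.
have deg2 (m : 'X_{1..2}) : mdeg m = (m ord0 + m ord_max)%N.
  rewrite mdegE big_ord_recl big_ord1; congr (_ + m _)%N; exact: val_inj.
have mE (m m' : 'X_{1..2}) : m \in msupp f -> m' \in msupp f ->
    m ord_max = m' ord_max -> m = m'.
  move=> /(dhomog_mf fh) hm /(dhomog_mf fh) hm' e.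
  have e0 : m ord0 = m' ord0.
    by apply/eqP; rewrite -(eqn_add2r (m ord_max)) {2}e -!deg2 hm hm'.
  apply/mnmP => i; case: i => [[|[|//]] hi].
    by rewrite (_ : Ordinal hi = ord0) //; apply: val_inj.
  by rewrite (_ : Ordinal hi = ord_max) //; apply: val_inj.
pose p : {poly int} := \sum_(m <- msupp f) f@_m *: 'X^(m ord_max).
have p0 : p != 0.
  have m0s := mlead_supp f0.
  apply/eqP => /polyP /(_ (mlead f ord_max)).
  rewrite coef0 coef_sum (bigD1_seq _ m0s (msupp_uniq f)) /=.
  rewrite coefZ coefXn eqxx mulr1 big_seq_cond big1 ?addr0.
    by apply/eqP; rewrite mleadc_eq0.
  move=> m /andP[ms mn]; rewrite coefZ coefXn eq_sym.
  by case: eqP => [e|_]; [rewrite (mE _ _ ms m0s e) eqxx in mn | rewrite mulr0].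
have [t pt] : exists t, p.[t] != 0.
  have : ~~ all (root p) [seq i%:Z | i <- iota 0 (size p)].
    apply/negP => /(max_poly_roots p0).
    rewrite size_map size_iota ltnn map_inj_uniq ?iota_uniq; last by move=> ? ? [].
    by move=> /(_ isT).
  by case/allPn => t _ nt; exists t.
pose g : 'M[int]_2 := \matrix_(i, j)
  (if i == ord0 then (j == ord0)%:R else if j == ord0 then t else 1).
exists (subst_form g f); exists g; last split=> //.
  rewrite unitmxE det_trig; last first.
    by apply/is_trig_mxP => -[[|[|//]] ?] [[|[|//]] ?]; rewrite // mxE.
  by rewrite big_ord_recl big_ord1 !mxE /= mulr1 unitr1.
have gh : subst_form g f \is n.-homog.
  rewrite /subst_form comp_mpolyEX big_seq; apply: rpred_sum => m ms.
  apply: dhomogZ; rewrite -(dhomog_mf fh ms) /= comp_mpolyX mdegE.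
  rewrite !big_ord_recl !big_ord0 !tnth_mktuple mulr1 addn0.
  have L i k : (\sum_(j < 2) g i j *: 'X_j) ^+ k \is k.-homog.
    rewrite -[X in X.-homog]mul1n; apply: dhomogMn.
    by apply: rpred_sum => j _; rewrite dhomogZ // dhomogX /= mdeg1.
  by apply: dhomogM; apply: L.
have evE (h : {mpoly int[2]}) : h \is n.-homog ->
    h.@[fun i => (i == ord0)%:R] = fcoef n h 0.
  move=> hh; rewrite /fcoef; set m0 := Multinom _.
  rewrite [in RHS](mpolyE h) mevalE linear_sum /= !big_seq.
  apply: eq_bigr => m /(dhomog_mf hh) hm.
  rewrite mcoeffZ mcoeffX big_ord_recl big_ord1 /= expr1n mul1r; congr (_ * _).
  rewrite expr0n (_ : lift _ _ = ord_max); last exact: val_inj.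
  congr (nat_of_bool _)%:R; apply/eqP/eqP => [e|->]; last by [].
  apply/mnmP => i; case: i => [[|[|//]] hi].
    rewrite (_ : Ordinal hi = ord0); last exact: val_inj.
    move: hm; rewrite /= deg2 e addn0 => ->.
    by rewrite /m0 multinomE (tnth_nth 0%N) /= subn0.
  rewrite (_ : Ordinal hi = ord_max); last exact: val_inj.
  by rewrite e.
rewrite -(evE _ gh) /subst_form comp_mpoly_meval.
suff -> : f.@[fun i => (tnth [tuple \sum_(j < 2) g i j *: 'X_j | i < 2] i).@[
    fun i => (i == ord0)%:R]] = p.[t] by [].
rewrite mevalE /p horner_sum; apply: eq_bigr => m _.
rewrite hornerZ hornerXn; congr (_ * _).
rewrite big_ord_recl big_ord1 !tnth_mktuple !linear_sum /= !big_ord_recl !big_ord0.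
rewrite !mevalZ !mevalXU !mxE /= !(mulr1, mulr0, addr0) expr1n mul1r.
by congr (_ ^+ (m _)); apply: val_inj.
Qed.

(* Main.v *)
Require Import Defs.
From mathcomp Require Import all_boot all_order all_algebra.
From mathcomp Require Import ring.

(* Everything follows from theta eta_k = zeta_(k+1) = eta_(k+1) - f_(k+1) and
   eta_n = 0.  They make I^# stable under R and show that I I^# is the span of
   f_0, ..., f_n, zeta_1, ..., zeta_(n-1): this is R when f is primitive, and
   when d divides all f_k it misses 1 unless d is a unit.  Modulo I^#, every
   element of R is an integer u, and u theta lies in R only if f_0 divides u,
   whence (R : I) = I^#.  Finally, if d divides all f_k then (f_0 / d) theta
   multiplies I^# into itself; were I^# invertible, this element would lie in R,
   forcing d to be a unit.  When f_0 = 0, f is replaced by a GL_2(Z)-translate,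
   which does not affect primitivity. *)

Set Implicit Arguments.
Unset Strict Implicit.
Unset Printing Implicit Defensive.

Import GRing.Theory Num.Theory.
Local Open Scope ring_scope.

(** * Additive subgroups, integer spans and products of subsets; Bezout combinations *)

Section IntSpan.
Variable T : comNzRingType.
Implicit Types (A B : T -> Prop) (x y : T).

Definition subgroup A := A 0 /\ forall x y, A x -> A y -> A (x - y).

Lemma subgroupN A x : subgroup A -> A x -> A (- x).
Proof. by case=> A0 AB Ax; rewrite -sub0r; apply: AB. Qed.

Lemma subgroupD A x y : subgroup A -> A x -> A y -> A (x + y).
Proof.
move=> sA Ax Ay; rewrite -[y]opprK.
by apply: sA.2 => //; apply: subgroupN.
Qed.

Lemma subgroup_sum A I (r : seq I) (P : pred I) (F : I -> T) : subgroup A ->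
  (forall i, P i -> A (F i)) -> A (\sum_(i <- r | P i) F i).
Proof.
move=> sA AF; apply: big_ind => //; first exact: sA.1.
by move=> x y; apply: subgroupD.
Qed.

Lemma subgroupMz A x (u : int) : subgroup A -> A x -> A (x *~ u).
Proof.
move=> sA Ax; have An k : A (x *+ k).
  by elim: k => [|k IHk]; [exact: sA.1 | rewrite mulrS; apply: subgroupD].
case: u => k; first by rewrite -pmulrn.
by rewrite NegzE mulrNz -pmulrn; apply: subgroupN => //; apply: An.
Qed.

Lemma subgroup_preim A y : subgroup A -> subgroup (fun x => A (x * y)).
Proof.
move=> sA; split; first by rewrite mul0r; exact: sA.1.
by move=> x z Ax Az; rewrite mulrBl; apply: sA.2.
Qed.

(** Coefficients indexed by [nat] can be shifted and modified at 0 without ordinal casts. *)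
Lemma inIntSpanP m (g : nat -> T) x :
  inIntSpan [tuple g k | k < m] x <->
  exists b : nat -> int, x = \sum_(k < m) g k *~ b k.
Proof.
have nthg (i : 'I_m) : [tuple g k | k < m]`_i = g i.
  by rewrite -tnth_nth tnth_mktuple.
split=> [[b ->] | [b ->]].
  (* The empty family is separate, since [inord] needs a nonempty ordinal type. *)
  case: m => [|m] in b nthg *; first by exists (fun=> 0); rewrite !big_ord0.
  exists (fun k => b (inord k)); apply: eq_bigr => i _.
  by rewrite nthg inord_val.
exists [ffun k : 'I_m => b k]; apply: eq_bigr => i _.
by rewrite nthg ffunE.
Qed.

Lemma inIntSpan_subgroup m (s : m.-tuple T) : subgroup (inIntSpan s).
Proof.
split=> [|_ _ [b ->] [c ->]].
  by exists [ffun=> 0]; rewrite big1 // => i _; rewrite ffunE mulr0z.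
exists [ffun i => b i - c i]; rewrite -sumrB; apply: eq_bigr => i _.
by rewrite ffunE mulrzBr.
Qed.

Lemma mem_inIntSpan m (g : nat -> T) k : (k < m)%N ->
  inIntSpan [tuple g k | k < m] (g k).
Proof.
move=> km; apply/inIntSpanP; exists (fun j => (j == k)%:Z).
rewrite (bigD1 (Ordinal km)) //= eqxx mulr1z big1 ?addr0 // => i.
by rewrite -val_eqE /= => /negPf ->; rewrite mulr0z.
Qed.

Lemma inIntSpan_min m (g : nat -> T) A x : subgroup A ->
  (forall k, (k < m)%N -> A (g k)) -> inIntSpan [tuple g k | k < m] x -> A x.
Proof.
move=> sA Ag /inIntSpanP [b ->]; apply: subgroup_sum => // k _.
by apply: subgroupMz => //; apply: Ag.
Qed.

Lemma prod_sub_gen A B x y : A x -> B y -> prod_sub A B (x * y).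
Proof.
move=> Ax By; exists [:: (x, y)]; rewrite big_seq1; split=> //.
by move=> p; rewrite inE => /eqP ->.
Qed.

Lemma prod_subD A B x y :
  prod_sub A B x -> prod_sub A B y -> prod_sub A B (x + y).
Proof.
move=> [r [rAB ->]] [s [sAB ->]]; exists (r ++ s); rewrite big_cat; split=> //.
by move=> p; rewrite mem_cat => /orP[/rAB|/sAB].
Qed.

Lemma prod_sub_sum A B I (r : seq I) (F : I -> T) :
  (forall i, prod_sub A B (F i)) -> prod_sub A B (\sum_(i <- r) F i).
Proof.
move=> ABF; apply: big_ind => // [|x y]; last exact: prod_subD.
by exists [::]; rewrite big_nil.
Qed.

Lemma prod_sub_min A B M x : subgroup M ->
  (forall y z, A y -> B z -> M (y * z)) -> prod_sub A B x -> M x.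
Proof.
move=> sM ABM [s [sAB ->]]; rewrite big_seq; apply: subgroup_sum => // p ps.
by have [Ap Bp] := sAB p ps; apply: ABM.
Qed.

Lemma prod_subC A B x : prod_sub A B x -> prod_sub B A x.
Proof.
move=> [s [sAB ->]]; exists [seq (p.2, p.1) | p <- s]; split.
  by move=> _ /mapP [p /sAB [? ?] ->].
by rewrite big_map; apply: eq_bigr => p _; rewrite mulrC.
Qed.

Lemma is_inverse_sym A B M : is_inverse M A B -> is_inverse M B A.
Proof.
move=> [MA MB AB]; split=> // x.
by split=> [/prod_subC/AB|/AB/prod_subC].
Qed.

Lemma Rspan2P A y z x : Rspan A [:: y; z] x <->
  exists c d, [/\ A c, A d & x = c * y + d * z].
Proof.
split=> [[c [Ac ->]] | [c [d [Ac Ad ->]]]].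
  exists (c ord0), (c ord_max); split=> //.
  rewrite big_ord_recl big_ord1 /=; congr (_ + c _ * _); exact: val_inj.
exists (fun i => if i == ord0 then c else d); split=> [i|].
  by case: ifP.
by rewrite big_ord_recl big_ord1.
Qed.

End IntSpan.

(** The combination is a gcd of the family: by induction, Bezout is applied to the head and to the
    gcd already obtained for the tail. *)
Lemma bezout_family m (a : 'I_m -> int) :
  exists c : 'I_m -> int, forall i, (\sum_j c j * a j %| a i)%Z.
Proof.
elim: m a => [|m IHm] a; first by exists (fun=> 0); case.
have [c cP] := IHm (fun i => a (lift ord0 i)).
have [u [v uv]] := Bezoutz (a ord0) (\sum_j c j * a (lift ord0 j)).
exists (fun i => if unlift ord0 i is Some j then v * c j else u) => i.
rewrite big_ord_recl unlift_none.
under eq_bigr => j _ do rewrite liftK -mulrA.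
rewrite -mulr_sumr uv.
case: (unliftP ord0 i) => [j|] ->; last exact: dvdz_gcdl.
exact: dvdz_trans (dvdz_gcdr _ _) (cP j).
Qed.

Lemma bezout1 m (a : 'I_m -> int) :
  (forall d, (forall i, (d %| a i)%Z) -> (d %| 1)%Z) ->
  exists c : 'I_m -> int, \sum_i c i * a i = 1.
Proof.
move=> a1; have [c cP] := bezout_family a.
have /dvdzP [u u1] := a1 _ cP.
exists (fun i => u * c i); rewrite [RHS]u1 mulr_sumr.
by apply: eq_bigr => i _; rewrite mulrA.
Qed.

(** * The lattices R, I and I^# for an abstract root t, and coordinates in the basis zeta *)

Section FormRing.
Variables (T : comNzRingType) (n : nat) (a : nat -> int) (t : T).

(** The formulas of [eta] and [zeta] in any commutative ring. All that is assumed of [t] is [e_n],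
    the equation of the form, and [t_inj], the independence of 1, t, ..., t^(n-1) over the
    integers. *)
Definition eta_at k : T := \sum_(i < k.+1) (a i)%:~R * t ^+ (k - i).
Definition zeta_at k : T :=
  if k == 0%N then 1 else \sum_(i < k) (a i)%:~R * t ^+ (k - i).

Local Notation e := eta_at.
Local Notation z := zeta_at.

Let R : T -> Prop := inIntSpan [tuple z k | k < n].
Let J : T -> Prop := inIntSpan [tuple e k | k < n].
Let I : T -> Prop := Rspan R [:: 1; t].

Hypothesis n_ge2 : (2 <= n)%N.
Hypothesis a0_neq0 : a 0 != 0.
Hypothesis e_n : e n = 0.
Hypothesis t_inj : forall p : {poly int},
  (size p <= n)%N -> (map_poly intr p).[t] = 0 -> p = 0.

Let n_gt0 : (0 < n)%N := ltnW n_ge2.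

Lemma eta_at0 : e 0 = (a 0)%:~R.
Proof. by rewrite /e big_ord1 expr0 mulr1. Qed.

Lemma zeta_atS k : z k.+1 = t * e k.
Proof.
rewrite /z /e /= mulr_sumr; apply: eq_bigr => i _.
by rewrite mulrCA -exprS -subSn // -ltnS.
Qed.

Lemma eta_atS k : e k.+1 = t * e k + (a k.+1)%:~R.
Proof.
rewrite -zeta_atS /z /e /= big_ord_recr /= subnn mulr1; congr (_ + _).
Qed.

(** A lift of [e k] to a polynomial of degree k, by Horner's scheme, to which [t_inj] can be
    applied. *)
Fixpoint eta_poly k : {poly int} :=
  if k is k'.+1 then eta_poly k' * 'X + (a k)%:P else (a 0)%:P.

Lemma eta_polyE k : (map_poly intr (eta_poly k)).[t] = e k.
Proof.
elim: k => [|k IHk]; first by rewrite /= map_polyC hornerC eta_at0.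
by rewrite /= rmorphD rmorphM /= map_polyX map_polyC !hornerE IHk eta_atS mulrC.
Qed.

Lemma size_eta_poly k : (size (eta_poly k) <= k.+1)%N.
Proof.
elim: k => [|k IHk]; first exact: size_polyC_leq1.
by rewrite /= size_MXaddC; case: ifP.
Qed.

Lemma coef_eta_poly k : (eta_poly k)`_k = a 0.
Proof.
elim: k => [|k IHk]; first by rewrite coefC.
by rewrite /= coefD coefMX coefC /= IHk addr0.
Qed.

(** Each [eta_poly k] has degree exactly k and leading coefficient [a 0], so comparing top
    coefficients kills the c_k with k > 0 one after the other. *)
Lemma eta_poly_const m (c : nat -> int) v :
  \sum_(k < m.+1) c k *: eta_poly k = v%:P -> v = c 0 * a 0.
Proof.
elim: m => [|m IHm].
  by rewrite big_ord1 /= -mul_polyC -polyCM => /polyC_inj.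
rewrite big_ord_recr /= => Ev.
have /eqP := congr1 (fun p : {poly int} => p`_m.+1) Ev.
rewrite coefD coef_sum big1 => [|k _]; last first.
  rewrite coefZ nth_default ?mulr0 // (leq_trans (size_eta_poly k)) //.
rewrite -/(eta_poly m.+1) coefZ coef_eta_poly coefC add0r mulf_eq0.
rewrite (negPf a0_neq0) orbF => /eqP c0.
by apply: IHm; rewrite -Ev c0 scale0r addr0.
Qed.

(** Since zeta_(k+1) = t e_k, the relation says that a polynomial of degree less than n vanishes at
    t; hence it is zero. *)
Lemma zeta_at_coord (b : nat -> int) u v :
  \sum_(k < n) z k *~ b k = u%:~R + v%:~R * t -> b 0 = u /\ v = b 1 * a 0.
Proof.
case: n n_ge2 t_inj => [|[|m]] // _ inj.
rewrite big_ord_recl => Ez.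
(* The relation becomes t q(t) + (b_0 - u) = 0. *)
pose q := \sum_(k < m.+1) b k.+1 *: eta_poly k - v%:P.
have qt : t * (map_poly intr q).[t] = (u - b 0)%:~R.
  rewrite /q rmorphB rmorph_sum /= map_polyC hornerD hornerN horner_sum hornerC.
  have -> : (u - b 0)%:~R = u%:~R + v%:~R * t - (b 0)%:~R - v%:~R * t :> T.
    by rewrite intrB; ring.
  rewrite -Ez {1}/z /= [1 *~ _ + _]addrC addrK mulrBr mulr_sumr mulrC.
  congr (_ - _); apply: eq_bigr => k _.
  rewrite map_polyZ hornerZ eta_polyE /bump /= add1n zeta_atS.
  by rewrite mulrCA mulrzl.
have /inj p0 : (map_poly intr (q * 'X + (b 0 - u)%:P)).[t] = 0.
  rewrite rmorphD rmorphM /= map_polyX map_polyC hornerMXaddC mulrC qt.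
  by rewrite -intrD -[u - b 0]opprB addNr.
(* Here n = m + 2, so q 'X plus a constant has size at most n, as [t_inj] requires. *)
have sq : (size q <= m.+1)%N.
  rewrite /q (leq_trans (size_polyD _ _)) // size_polyN geq_max.
  rewrite (leq_trans (size_polyC_leq1 _)) // andbT.
  apply: (leq_trans (size_sum _ _ _)); apply/bigmax_leqP => k _.
  rewrite (leq_trans (size_scale_leq _ _)) // (leq_trans (size_eta_poly _)) //.
have {p0} p0 : q * 'X + (b 0 - u)%:P = 0.
  by apply: p0; rewrite size_MXaddC; case: ifP.
have /eqP := congr1 (fun p : {poly int} => p`_0) p0.
rewrite coefD coefMX coefC coef0 add0r subr_eq0 => /eqP bu; split=> //.
move: p0; rewrite bu subrr addr0 => /eqP; rewrite mulf_eq0 polyX_eq0 orbF.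
rewrite subr_eq0 => /eqP; exact: (eta_poly_const (c := fun k => b k.+1)).
Qed.

(** * Stability of I^# under multiplication by R *)

Lemma Jz_mul u x : J x -> J (u%:~R * x).
Proof.
by move=> Jx; rewrite mulrzl; apply: subgroupMz Jx; apply: inIntSpan_subgroup.
Qed.

Lemma eta_in_J k : (k < n)%N -> J (e k).
Proof. exact: mem_inIntSpan. Qed.

Lemma J_subgroup : subgroup J.
Proof. exact: inIntSpan_subgroup. Qed.

Lemma R_subgroup : subgroup R.
Proof. exact: inIntSpan_subgroup. Qed.

Lemma R1 : R 1.
Proof. exact: (@mem_inIntSpan _ _ z 0). Qed.

Lemma R_int u : R u%:~R.
Proof. by apply: subgroupMz R1; apply: R_subgroup. Qed.

(* Both e_(i+1) e_j - a_(i+1) e_j and e_i e_(j+1) - a_(j+1) e_i equal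
   t e_i e_j, and e_n = 0, so that J-membership descends to i = 0. *)
Lemma eta_mul_in_J i j : (i <= n)%N -> (j <= n)%N -> J (e i * e j).
Proof.
elim: i j => [|i IHi] j le_in.
  rewrite leq_eqVlt => /predU1P [->|jn].
    by rewrite e_n mulr0; exact: J_subgroup.1.
  by rewrite eta_at0; apply/Jz_mul/eta_in_J.
rewrite leq_eqVlt => /predU1P [->|jn].
  by rewrite e_n mulr0; exact: J_subgroup.1.
have -> : e i.+1 * e j =
    e i * e j.+1 - (a j.+1)%:~R * e i + (a i.+1)%:~R * e j.
  by rewrite !eta_atS; ring.
apply: subgroupD; [exact: J_subgroup| |exact/Jz_mul/eta_in_J].
apply: J_subgroup.2; first by apply: IHi => //; apply: ltnW.
exact/Jz_mul/eta_in_J.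
Qed.

(** On generators, zeta_(k+1) e_j = e_(k+1) e_j - a_(k+1) e_j, and products of two etas lie in J. *)
Lemma R_mul_J x y : R x -> J y -> J (x * y).
Proof.
move=> Rx Jy; apply: (inIntSpan_min (subgroup_preim y J_subgroup) _ Rx) => k kn.
rewrite mulrC; apply: (inIntSpan_min (subgroup_preim _ J_subgroup) _ Jy) => j jn.
case: k kn => [|k] kn; first by rewrite mulr1; apply: eta_in_J.
rewrite zeta_atS (_ : _ * _ = e k.+1 * e j - (a k.+1)%:~R * e j).
  apply: J_subgroup.2; last exact/Jz_mul/eta_in_J.
  by apply: eta_mul_in_J; apply: ltnW.
by rewrite eta_atS; ring.
Qed.

(** * A common divisor d of the coefficients bounds the product I I^# *)

Section Content.
Variable d : int.
Hypothesis d_dvd : forall k, (k <= n)%N -> (d %| a k)%Z.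

(** The basis of R with 1 replaced by d. Its span [Rd] contains I J, and contains 1 only if d is a
    unit; for d = 1 it is R itself. *)
Let g k : T := if k == 0 :> nat then d%:~R else z k.
Let Rd : T -> Prop := inIntSpan [tuple g k | k < n].

Let Rd_subgroup : subgroup Rd. Proof. exact: inIntSpan_subgroup. Qed.

Lemma Rd_a k : (k <= n)%N -> Rd (a k)%:~R.
Proof.
move=> kn; have /dvdzP [u ->] := d_dvd kn.
rewrite mulrC intrM mulrzr; apply: subgroupMz => //.
exact: (@mem_inIntSpan _ n g 0).
Qed.

Lemma Rd_zeta k : (k.+1 < n)%N -> Rd (t * e k).
Proof. by move=> kn; rewrite -zeta_atS; apply: (@mem_inIntSpan _ _ g k.+1). Qed.

Lemma J_sub_Rd x : J x -> Rd x.
Proof.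
move=> Jx; apply: (inIntSpan_min _ _ Jx) => // -[|k] kn.
  by rewrite eta_at0; apply: Rd_a.
rewrite eta_atS; apply: subgroupD => //; first exact: Rd_zeta.
by apply: Rd_a; apply: ltnW.
Qed.

Lemma tJ_sub_Rd x : J x -> Rd (x * t).
Proof.
move=> Jx; apply: (inIntSpan_min (subgroup_preim t Rd_subgroup) _ Jx) => // k kn.
rewrite mulrC; have [kn1|] := ltnP k.+1 n; first exact: Rd_zeta.
(* There is no zeta_n in the basis: at the last index, t e_(n-1) = e_n - a_n = - a_n. *)
move=> nk; have Ek : k.+1 = n by apply/eqP; rewrite eqn_leq kn.
rewrite -[t * _](addrK (a k.+1)%:~R) -eta_atS Ek e_n sub0r.
by apply: subgroupN => //; apply: Rd_a.
Qed.

Lemma IJ_sub_Rd x y : I x -> J y -> Rd (x * y).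
Proof.
move=> /Rspan2P [b [c [Rb Rc ->]]] Jy.
rewrite mulr1 mulrDl mulrAC; apply: subgroupD => //.
  exact/J_sub_Rd/R_mul_J.
exact/tJ_sub_Rd/R_mul_J.
Qed.

(** The coordinate of 1 at zeta_0 is 1, while on [Rd] it is a multiple of d. *)
Lemma Rd1_dvd : Rd 1 -> (d %| 1)%Z.
Proof.
move/inIntSpanP => [b Eb].
have [] := @zeta_at_coord (fun k => if k == 0 :> nat then d * b 0 else b k) 1 0.
  rewrite mul0r addr0 [RHS]Eb; apply: eq_bigr => k _; rewrite /g /z.
  by case: eqP => // ->; rewrite -mulrzr mul1r intrM mulrzr.
by move=> /= E _; apply/dvdzP; exists (b 0); rewrite mulrC E.
Qed.

End Content.

(** * The case d = 1, and I^# as the colon ideal (R : I) *)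

Let dvd1z k : (k <= n)%N -> (1 %| a k)%Z.
Proof. by rewrite dvd1z. Qed.

Lemma R_eq_Rd x :
  inIntSpan [tuple (if k == 0 :> nat then 1%:~R else z k) | k < n] x -> R x.
Proof.
move/(inIntSpanP _ (fun k => if k == 0 :> nat then 1%:~R else z k)) => [b ->].
by apply/inIntSpanP; exists b; apply: eq_bigr => -[[|k] kn] _.
Qed.

Lemma IJ_sub_R x y : I x -> J y -> R (x * y).
Proof. by move=> Ix Jy; apply: R_eq_Rd; apply: IJ_sub_Rd. Qed.

Lemma R_sub_I x : R x -> I x.
Proof.
move=> Rx; apply/Rspan2P; exists x, 0; split=> //; first exact: R_subgroup.1.
by rewrite mul0r addr0 mulr1.
Qed.

Lemma Rt_sub_I x : R x -> I (x * t).
Proof.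
move=> Rx; apply/Rspan2P; exists 0, x; split=> //; first exact: R_subgroup.1.
by rewrite mul0r add0r.
Qed.

(** Modulo J, zeta_(k+1) = e_(k+1) - a_(k+1) is the integer - a_(k+1). *)
Lemma R_sub_JZ x : R x -> exists u : int, J (x - u%:~R).
Proof.
apply: (inIntSpan_min (A := fun y => exists u : int, J (y - u%:~R))) => [|k kn].
  split=> [|y w [u Ju] [v Jv]].
    by exists 0; rewrite subr0; exact: J_subgroup.1.
  exists (u - v); rewrite intrB.
  rewrite (_ : _ - _ = (y - u%:~R) - (w - v%:~R)); last by ring.
  exact: J_subgroup.2.
case: k kn => [|k] kn; first by exists 1; rewrite subrr; exact: J_subgroup.1.
exists (- a k.+1); rewrite zeta_atS intrN opprK -eta_atS; exact: eta_in_J.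
Qed.

(** In the basis zeta, t itself enters through zeta_1 = a_0 t. *)
Lemma R_coord1 u : R (u%:~R * t) -> exists v, u = v * a 0.
Proof.
move/inIntSpanP => [b Eb]; exists (b 1).
by have [] := @zeta_at_coord b 0 u; rewrite ?add0r.
Qed.

Lemma J_colon : eq_sub J (colon R I).
Proof.
move=> x; split=> [Jx y Iy|RIx]; first by rewrite mulrC; apply: IJ_sub_R.
have Rx : R x by rewrite -[x]mulr1; apply/RIx/R_sub_I/R1.
have Rxt : R (x * t) by apply: RIx; rewrite -[t]mul1r; apply/Rt_sub_I/R1.
have [u Ju] := R_sub_JZ Rx.
have [v uv] : exists v, u = v * a 0.
  (* Both terms lie in R: the first by the choice of x, the second because I J is contained in R. *)
  apply: R_coord1; rewrite (_ : _ * t = x * t - t * (x - u%:~R)); last by ring.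
  apply: R_subgroup.2 => //; apply: IJ_sub_R => //.
  by rewrite -[t]mul1r; apply/Rt_sub_I/R1.
rewrite -[x](subrK u%:~R); apply: subgroupD => //; first exact: J_subgroup.
by rewrite uv intrM -eta_at0; apply/Jz_mul/eta_in_J.
Qed.

(** The integer span of the etas is already their R-span, as J is R-stable. *)
Lemma J_fractional : fractional R J.
Proof.
exists [tuple e k | k < n] => x; split=> [|[c [Rc ->]]].
  move=> [b ->]; rewrite /Rspan size_tuple; exists (fun i => (b i)%:~R).
  by split=> [i|]; [exact: R_int | apply: eq_bigr => i _; rewrite mulrzl].
apply: subgroup_sum => [|i _]; first exact: J_subgroup.
apply: R_mul_J => //; have := ltn_ord i; rewrite [X in (_ < X)%N]size_tuple => ni.
rewrite (_ : _`_i = e i); first exact: eta_in_J.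
by rewrite -[val i]/(val (Ordinal ni)) -tnth_nth tnth_mktuple.
Qed.

(** * Invertibility of I and I^# against coprimality of the coefficients *)

Definition coprime_coefs := exists c : 'I_n.+1 -> int, \sum_(i < n.+1) c i * a i = 1.

Lemma I_inverse : coprime_coefs -> is_inverse R I J.
Proof.
move=> [c c1]; split; [by exists [:: 1; t] | exact: J_fractional |].
move=> x; split; first by apply: prod_sub_min R_subgroup _; apply: IJ_sub_R.
(* Expanding 1 as a combination of the a_k reduces the claim to y a_k in I J for y in R; then a_0 =
   e_0 and a_(k+1) = e_(k+1) - t e_k. *)
move=> Rx; rewrite -[x]mulr1 -[1]/(1%:~R) -c1 rmorph_sum mulr_sumr.
apply: prod_sub_sum => -[k kn] /=; rewrite intrM mulrA.
have {Rx} Rx : R (x * (c (Ordinal kn))%:~R).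
  by rewrite mulrzr; apply: subgroupMz Rx; apply: R_subgroup.
move: (x * _) Rx => y Ry {c c1 x}.
case: k kn => [|k] kn.
  by rewrite -eta_at0; apply: prod_sub_gen; [apply: R_sub_I|apply: eta_in_J].
rewrite (_ : y * _ = y * e k.+1 + (- y * t) * e k); last by rewrite eta_atS; ring.
apply: prod_subD.
  apply: prod_sub_gen; first exact: R_sub_I.
  move: kn; rewrite ltnS leq_eqVlt => /predU1P [->|]; last exact: eta_in_J.
  by rewrite e_n; exact: J_subgroup.1.
apply: prod_sub_gen; last exact: eta_in_J.
by apply: Rt_sub_I; apply: subgroupN => //; apply: R_subgroup.
Qed.

Lemma coprime_coefsP :
  (forall d, (forall k, (k <= n)%N -> (d %| a k)%Z) -> (d %| 1)%Z) ->
  coprime_coefs.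
Proof.
move=> a1; apply: bezout1 => d da; apply: a1 => k kn.
exact: (da (Ordinal (kn : (k < n.+1)%N))).
Qed.

(** An inverse K lies in (R : I) = J, so 1 lies in I K, hence in I J and in [Rd]. *)
Lemma I_invertible : invertible R I -> coprime_coefs.
Proof.
move=> [K [_ _ IK]]; apply: coprime_coefsP => d da; apply: (Rd1_dvd (d := d)).
apply: (prod_sub_min _ _ ((IK 1).2 R1)); first exact: inIntSpan_subgroup.
move=> x y Ix Ky; apply: IJ_sub_Rd => //; apply/J_colon => w Iw.
by rewrite mulrC; apply/IK; apply: prod_sub_gen.
Qed.

Lemma J_invertible : invertible R J -> coprime_coefs.
Proof.
move=> [K [_ _ JK]]; apply: coprime_coefsP => d da.
have /dvdzP [g a0E] := da 0 (leq0n n).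
have gJ x : J x -> J (x * (g%:~R * t)).
  move=> Jx; apply: (inIntSpan_min (subgroup_preim _ J_subgroup) _ Jx) => j jn.
  have /dvdzP [h ajE] := da _ jn.
  (* With a_0 = g d and a_(j+1) = h d, the term g a_(j+1) equals h a_0. *)
  rewrite (_ : e j * _ = g%:~R * e j.+1 - h%:~R * e 0); last first.
    by rewrite eta_atS eta_at0 ajE a0E !intrM; ring.
  apply: J_subgroup.2; last exact/Jz_mul/eta_in_J.
  move: jn; rewrite leq_eqVlt => /predU1P [->|]; last by move/eta_in_J/Jz_mul.
  by rewrite e_n mulr0; exact: J_subgroup.1.
have [v gE] : exists v, g = v * a 0.
  (* As 1 lies in J K and g t maps J to J, the element g t lies in J K = R. *)
  apply: R_coord1; rewrite -[_ * t]mul1r.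
  apply: (prod_sub_min (subgroup_preim _ R_subgroup) _ ((JK 1).2 R1)).
  move=> x y Jx Ky; rewrite mulrAC; apply/JK.
  by apply: prod_sub_gen => //; apply: gJ.
(* Now g = v a_0 = v g d, and g is nonzero because a_0 is. *)
apply/dvdzP; exists v; apply: (@mulIf _ g).
  by apply: contraNneq a0_neq0 => g0; rewrite a0E g0 mul0r.
by rewrite mul1r {1}gE a0E; ring.
Qed.

End FormRing.

(** * Linear substitutions and primitivity *)

Definition form_mon n k : 'X_{1..2} := [multinom [tuple (n - k)%N; k]].

Lemma form_mon0 n k : form_mon n k ord0 = (n - k)%N.
Proof. by rewrite multinomE. Qed.

Lemma form_mon1 n k : form_mon n k ord_max = k.
Proof. by rewrite multinomE. Qed.

Lemma mdeg2 (m : 'X_{1..2}) : mdeg m = (m ord0 + m ord_max)%N.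
Proof.
rewrite mdegE big_ord_recl big_ord1; congr (_ + m _)%N; exact: val_inj.
Qed.

Lemma mnm2P (m m' : 'X_{1..2}) :
  m ord0 = m' ord0 -> m ord_max = m' ord_max -> m = m'.
Proof.
move=> e0 e1; apply/mnmP => -[[|[|//]] hi].
  by rewrite (_ : Ordinal hi = ord0) //; apply: val_inj.
by rewrite (_ : Ordinal hi = ord_max) //; apply: val_inj.
Qed.

Lemma homog_fcoefE n (f : {mpoly int[2]}) : f \is n.-homog ->
  f = \sum_(k < n.+1) fcoef n f k *: 'X_[form_mon n k].
Proof.
move=> fh; apply/mpolyP => m; rewrite raddf_sum /=.
under eq_bigr => k _ do rewrite mcoeffZ mcoeffX.
have [dm|dm] := eqVneq (mdeg m) n; last first.
  rewrite (dhomog_nemf_coeff fh dm) big1 // => k _.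
  case: eqP => [mE|]; last by rewrite mulr0.
  by case/eqP: dm; rewrite -mE mdeg2 form_mon0 form_mon1 subnK // -ltnS.
have mn : (m ord_max < n.+1)%N by rewrite ltnS -dm mdeg2 leq_addl.
have mE : form_mon n (m ord_max) = m.
  by apply: mnm2P; rewrite ?form_mon1 // form_mon0 -dm mdeg2 addnK.
rewrite (bigD1 (Ordinal mn)) //= mE eqxx mulr1 big1 ?addr0.
  by rewrite /fcoef -/(form_mon n _) mE.
move=> k; rewrite -val_eqE /= => km; case: eqP => [kE|]; last by rewrite mulr0.
by case/eqP: km; rewrite -kE form_mon1.
Qed.

(** The coefficients of the transformed form are integer combinations of those of f, with weights
    read off the transformed monomials. *)
Lemma primitive_of_subst n (g : 'M[int]_2) (f : {mpoly int[2]}) :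
  f \is n.-homog -> primitive_form n (subst_form g f) -> primitive_form n f.
Proof.
move=> fh [c c1].
exists (fun k : 'I_n.+1 =>
  \sum_(j < n.+1) c j * fcoef n (subst_form g 'X_[form_mon n k]) j).
rewrite -c1; under eq_bigr => k _ do rewrite mulr_suml.
rewrite exchange_big; apply: eq_bigr => j _ /=.
under eq_bigr => k _ do rewrite -mulrA.
rewrite -mulr_sumr; congr (_ * _).
rewrite [in RHS](homog_fcoefE fh) /subst_form linear_sum /fcoef raddf_sum /=.
by apply: eq_bigr => k _; rewrite comp_mpolyZ mcoeffZ mulrC.
Qed.

Lemma subst_form_homog n (g : 'M[int]_2) (f : {mpoly int[2]}) :
  f \is n.-homog -> subst_form g f \is n.-homog.
Proof.
move=> fh; rewrite /subst_form comp_mpolyEX big_seq; apply: rpred_sum => m ms.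
apply: dhomogZ; rewrite -(dhomog_mf fh ms) /= comp_mpolyX mdegE.
apply: (big_ind2 (fun (p : {mpoly int[2]}) d => p \is d.-homog)) => [|p d q d'|i _].
- exact: dhomog1.
- exact: dhomogM.
rewrite tnth_mktuple -[X in X.-homog]mul1n; apply: dhomogMn; apply: rpred_sum => j _.
by rewrite dhomogZ // dhomogX /= mdeg1.
Qed.

Lemma subst_formM (g h : 'M[int]_2) (f : {mpoly int[2]}) :
  subst_form h (subst_form g f) = subst_form (g *m h) f.
Proof.
rewrite {2}/subst_form [f \mPo _]comp_mpolyEX {1}/subst_form linear_sum /=.
rewrite /subst_form comp_mpolyEX; apply: eq_bigr => m _.
rewrite comp_mpolyZ !comp_mpolyX rmorph_prod; congr (_ *: _).
apply: eq_bigr => i _; rewrite rmorphXn /= !tnth_mktuple; congr (_ ^+ _).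
rewrite linear_sum /=.
under eq_bigr => j _ do
  rewrite comp_mpolyZ comp_mpolyXU -tnth_nth tnth_mktuple scaler_sumr.
rewrite exchange_big; apply: eq_bigr => k _ /=.
by rewrite mxE scaler_suml; apply: eq_bigr => j _; rewrite scalerA.
Qed.

Lemma subst_form1 (f : {mpoly int[2]}) : subst_form 1%:M f = f.
Proof.
rewrite -[RHS]comp_mpoly_id; congr (_ \mPo _); apply: eq_from_tnth => i.
rewrite !tnth_mktuple (bigD1 i) //= mxE eqxx scale1r big1 ?addr0 // => j ji.
by rewrite mxE eq_sym (negPf ji) scale0r.
Qed.

Lemma primitive_subst n (g : 'M[int]_2) (f : {mpoly int[2]}) :
  f \is n.-homog -> g \in unitmx ->
  primitive_form n (subst_form g f) <-> primitive_form n f.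
Proof.
move=> fh gu; split; first exact: primitive_of_subst.
(* f is the translate of [subst_form g f] by the inverse matrix. *)
rewrite -{1}[f]subst_form1 -(mulmxV gu) -subst_formM.
exact/primitive_of_subst/subst_form_homog.
Qed.

(** * The algebra Q_f and its element theta satisfy the abstract hypotheses *)

Section QuotientRing.
Variables (n : nat) (f : {mpoly int[2]}).
Hypothesis n_ge2 : (2 <= n)%N.
Hypothesis f0 : fcoef n f 0 != 0.

Local Notation c0 := ((fcoef n f 0)%:~R : rat).
Local Notation h := (c0^-1 *: dehomog n f).

Let c0_neq0 : c0 != 0. Proof. by rewrite intr_eq0. Qed.

Lemma dehomogE :
  dehomog n f = \poly_(j < n.+1) (fcoef n f (n - j))%:~R.
Proof.
rewrite poly_def /dehomog (reindex_inj rev_ord_inj) /=.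
by apply: eq_bigr => -[k kn] _ /=; rewrite subSS subKn.
Qed.

Lemma size_dehomog : size h = n.+1.
Proof.
by rewrite size_scale ?invr_eq0 // dehomogE size_poly_eq //= subnn.
Qed.

Lemma monic_dehomog : h \is monic.
Proof.
rewrite monicE lead_coefZ dehomogE lead_coef_poly //= ?subnn //.
by rewrite mulVf.
Qed.

(** [mk_monic] falls back to 'X unless its argument is monic of positive degree; here the fallback
    does not occur, so [Qf] is the intended quotient. *)
Lemma mk_monic_dehomog : mk_monic h = h.
Proof. by rewrite /mk_monic size_dehomog monic_dehomog ltnS ltnW. Qed.

Lemma in_qpoly_horner (p : {poly int}) :
  (map_poly intr p).[theta n f] = in_qpoly h (map_poly intr p).
Proof.
elim/poly_ind: p => [|p c IHp]; first by rewrite !rmorph0 horner0.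
rewrite !rmorphD !rmorphM /= !map_polyX !map_polyC hornerMXaddC IHp.
congr (_ + _); by rewrite /= !rmorph_int.
Qed.

(** [eta n f n] is f(theta, 1), the class of a multiple of the modulus. *)
Lemma eta_n0 : eta n f n = 0.
Proof.
transitivity (in_qpoly h (dehomog n f)).
  rewrite /dehomog rmorph_sum /eta; apply: eq_bigr => i _.
  by rewrite scaler_int rmorphMz rmorphXn mulrzl.
apply: val_inj; rewrite /= mk_monic_dehomog.
rewrite -[X in Pdiv.Ring.rmodp X _](scalerKV c0_neq0) -mul_polyC.
by rewrite Pdiv.RingMonic.rmodp_mull ?monic_dehomog.
Qed.

(** The modulus has degree n, so a polynomial of smaller degree is its own remainder. *)
Lemma theta_inj (p : {poly int}) :
  (size p <= n)%N -> (map_poly intr p).[theta n f] = 0 -> p = 0.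
Proof.
move=> sp; rewrite in_qpoly_horner => p0.
have pE : in_qpoly h (map_poly intr p) = map_poly intr p :> {poly rat}.
  apply: in_qpoly_small; rewrite mk_monic_dehomog size_dehomog ltnS.
  exact: leq_trans (size_poly _ _) sp.
apply: (@map_inj_poly _ _ (intr : int -> rat)) => //; first exact: intr_inj.
by rewrite rmorph0 -pE p0.
Qed.

End QuotientRing.

Theorem propositionA4 (n : nat) (n_ge2 : (2 <= n)%N)
    (f : {mpoly int[2]}) (f_homog : f \is n.-homog) (f_neq0 : f != 0)
    (f' : {mpoly int[2]}) (f'_adm : admissible n f f') :
  let R := Rf n f' in
  let I := If n f' in
  let Isharp := Ifsharp n f' in
  [/\ invertible R I <-> primitive_form n f,
      invertible R Isharp <-> primitive_form n f,
      eq_sub Isharp (colon R I) &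
      primitive_form n f -> is_inverse R I Isharp].
Proof.
have [f'0 primE] : fcoef n f' 0 != 0 /\
    (primitive_form n f' <-> primitive_form n f).
  move: f'_adm; rewrite /admissible; case: ifP => [f0 ->|_]; first by split.
  by move=> [g gu [-> ?]]; split=> //; apply: primitive_subst.
(* At t = theta, the abstract R, I and J are [Rf], [If] and [Ifsharp] by conversion. *)
have en := eta_n0 n_ge2 f'0.
have inj := theta_inj n_ge2 f'0.
have inv := I_inverse n_ge2 en.
split.
- split=> [/(I_invertible n_ge2 f'0 en inj)/primE //|/primE/inv].
  by exists (Ifsharp n f').
- split=> [/(J_invertible n_ge2 f'0 en inj)/primE //|/primE/inv JI].
  by exists (If n f'); apply: is_inverse_sym.
- exact: J_colon n_ge2 f'0 en inj.
- by move/primE/inv.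
Qed.
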